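(* For every localic quantal groupoid $G$ and every multiplicative semiopen quantal frame $Q$, we have isomorphisms $\mathcal G(\mathcal O(G))\cong G$ (of localic groupoids) and $\mathcal O(\mathcal G(Q))\cong Q$ (of involutive quantales).
   Context: For a locale $X$, $\mathcal O(X)$ is its frame; a map of locales $f$ has inverse image $f^*$. $f$ is semiopen if $f^*$ has a left adjoint $f_!$. A localic groupoid is an internal groupoid in the category of locales, with domain $d$, range $r$, multiplication $m:G_2=G_1\times_{G_0}G_1\to G_1$ (composable pairs $(x,y)$ have $r(x)=d(y)$), units $u$, inversion $i$. It is quantal if $m$ is semiopen. For a quantal groupoid $G$, $\mathcal O(G)$ is the involutive quantale with underlying frame $\mathcal O(G_1)$, multiplication $\mathcal O(G_1)\otimes\mathcal O(G_1)\to\mathcal O(G_2)\xrightarrow{m_!}\mathcal O(G_1)$ (first map the frame quotient) and involution $a^*=i_!(a)$; it is a multiplicative semiopen quantal frame. A quantale is a sup-lattice with an associative multiplication preserving joins in each variable (not necessarily unital). An involutive quantal frame $Q$ is a quantale with a join-preserving involution ($a^{**}=a$, $(ab)^*=b^*a^*$) whose underlying lattice is a frame; $1$ is its top. $R(Q)=\{a\in Q:a1\le a\}$. $Q$ is an $R(Q)$-$R(Q)$-bimodule via $z\cdot a=a\wedge z$, $a\cdot z=a\wedge z^*$, and $Q\otimes_{R(Q)}Q$ is the corresponding tensor product of sup-lattices (quotient of $Q\otimes Q$ by $(a\wedge z^* )\otimes b=a\otimes(z\wedge b)$). $Q$ is balanced if $b(a1\wedge c)=(b\wedge 1a^* )c$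 for all $a,b,c$. If $Q$ is balanced and $R(Q)=Q1$, the multiplication factors through $\mu_0:Q\otimes_{R(Q)}Q\to Q$, $a\otimes b\mapsto ab$; $Q$ is multiplicative if it is balanced and the right adjoint $(\mu_0)_*$ preserves joins. Put $\upsilon(a)=\bigvee_{xy^*\le a}x\wedge y$. A balanced $Q$ is semiopen if $\upsilon(Q)\subset R(Q)$ and $\bigvee_{xx^*x\le a}x=a$ for all $a$ (this implies $R(Q)=Q1$). For a multiplicative semiopen quantal frame $Q$, $\mathcal G(Q)$ is the quantal groupoid $G$ with $\mathcal O(G_1)=Q$, $\mathcal O(G_0)=R(Q)$, $d^*(z)=z$, $r^*(z)=z^*$, $i^*(a)=a^*$, $\mathcal O(G_2)=Q\otimes_{R(Q)}Q$, $m^*=(\mu_0)_*$, $u^*=\upsilon$.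
   Formalization: With ''quantal'' meaning only m semiopen, O(G) can fail to be associative, so G(O(G)) is not always defined; here the formulas defining G(-) are applied to O(G) without requiring that it be a quantale, and O(G) is not claimed to be a multiplicative semiopen quantal frame. *)

(* Defs.v *)
From HB Require Import structures.
From mathcomp Require Import all_boot all_order.
From mathcomp Require Import boolp classical_sets.

Set Implicit Arguments.
Unset Strict Implicit.
Unset Printing Implicit Defensive.

Import Order.LTheory.
Local Open Scope classical_set_scope.
Local Open Scope order_scope.

Fact frame_display : Order.disp_t.
Proof. exact: (Order.Disp tt tt). Qed.

HB.mixin Record hasVee T of Order.TBLattice frame_display T := {
  Vee : set T -> T;
  Vee_ub : forall (S : set T) x, S x -> x <= Vee S;
  Vee_le : forall (S : set T) y, (forall x, S x -> x <= y) -> Vee S <= y;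
  meet_Vee_le : forall x (S : set T),
    x `&` Vee S <= Vee [set x `&` s | s in S]
}.

#[short(type="frameType")]
HB.structure Definition Frame :=
  { T of Order.TBLattice frame_display T & hasVee T }.

HB.factory Record POrder_isFrame T of Order.POrder frame_display T := {
  fmeet : T -> T -> T;
  fle_meet : forall x y z : T, (x <= fmeet y z) = (x <= y) && (x <= z);
  fVee : set T -> T;
  fVee_ub : forall (S : set T) x, S x -> x <= fVee S;
  fVee_le : forall (S : set T) y, (forall x, S x -> x <= y) -> fVee S <= y;
  fmeet_Vee_le : forall x (S : set T),
    fmeet x (fVee S) <= fVee [set fmeet x s | s in S]
}.

HB.builders Context T of POrder_isFrame T.

Let fjoin (x y : T) : T := fVee [set z | z = x \/ z = y].

Fact fle_join (x y z : T) : (fjoin x y <= z) = (x <= z) && (y <= z).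
Proof.
apply/idP/andP => [h|[hx hy]].
  by split; apply: le_trans h; apply: fVee_ub => /=; [left|right].
by apply: fVee_le => w /= [->|->].
Qed.

HB.instance Definition _ :=
  Order.POrder_MeetJoin_isLattice.Build frame_display T fle_meet fle_join.

Fact fbot_le (x : T) : fVee set0 <= x.
Proof. by apply: fVee_le => y []. Qed.

Fact fle_top (x : T) : x <= fVee setT.
Proof. exact: fVee_ub. Qed.

HB.instance Definition _ := Order.hasBottom.Build frame_display T fbot_le.
HB.instance Definition _ := Order.hasTop.Build frame_display T fle_top.
HB.instance Definition _ := hasVee.Build T fVee_ub fVee_le fmeet_Vee_le.

HB.end.

Definition Wedge (L : frameType) (S : set L) : L :=
  Vee [set y | forall x, S x -> y <= x].

Definition preserves_Vee (A B : frameType) (f : A -> B) : Prop :=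
  forall S : set A, f (Vee S) = Vee [set f a | a in S].

Record frame_hom (A B : frameType) (f : A -> B) : Prop := {
  fhom_top : f \top = \top;
  fhom_meet : forall x y, f (x `&` y) = f x `&` f y;
  fhom_Vee : preserves_Vee f
}.

Definition left_adjoint (A B : frameType) (g : B -> A) (f : A -> B) : Prop :=
  forall b a, (g b <= a) = (b <= f a).

(* A locale is given by its frame, and a map of locales X -> Y by its inverse
   image, a frame homomorphism O(Y) -> O(X).  *)
Definition semiopen (A B : frameType) (f : A -> B) : Prop :=
  exists g : B -> A, left_adjoint g f.

(* The only possible value of the left, resp. right, adjoint. *)
Definition ladj (A B : frameType) (f : A -> B) (b : B) : A :=
  Wedge [set a | b <= f a].
Definition radj (A B : frameType) (g : A -> B) (b : B) : A :=
  Vee [set a | g a <= b].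

Lemma ladj_unique (A B : frameType) (g : B -> A) (f : A -> B) :
  left_adjoint g f -> ladj f = g.
Proof.
move=> adj; apply/funext => b; apply/le_anti/andP; split.
  by apply: Vee_le => x /(_ (g b)); apply => /=; rewrite -adj.
by apply: Vee_ub => a /=; rewrite adj.
Qed.

Lemma radj_unique (A B : frameType) (g : B -> A) (f : A -> B) :
  left_adjoint g f -> radj g = f.
Proof.
move=> adj; apply/funext => a; apply/le_anti/andP; split.
  by apply: Vee_le => x /=; rewrite adj.
by apply: Vee_ub => /=; rewrite adj.
Qed.

(* The tensor product A (x)_C B of sup-lattices, where c in C acts on A by
   meet with f c and on B by meet with g c: its element t is represented by
   the set of all pairs (a, b) such that a (x) b <= t, and the sets so obtained
   are those saturated with respect to the defining relations of the tensor
   product.  *)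
Definition saturated (C A B : frameType) (f : C -> A) (g : C -> B)
    (U : set (A * B)) : Prop :=
  [/\ forall (S : set A) b, U (Vee S, b) <-> (forall a, S a -> U (a, b)),
      forall a (S : set B), U (a, Vee S) <-> (forall b, S b -> U (a, b))
    & forall a c b, U (a `&` f c, b) <-> U (a, g c `&` b)].

Record tensor (C A B : frameType) (f : C -> A) (g : C -> B) := Tensor {
  tset : set (A * B);
  tsetP : `[< saturated f g tset >]
}.

Section TensorFrame.
Variables (C A B : frameType) (f : C -> A) (g : C -> B).

HB.instance Definition _ := [isSub of tensor f g for @tset C A B f g].
HB.instance Definition _ := [Choice of tensor f g by <:].
HB.instance Definition _ :=
  [SubChoice_isSubPOrder of tensor f g by <: with frame_display].

Lemma le_tensor (U V : tensor f g) :
  U <= V <-> (tset U `<=` tset V)%classic.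
Proof. by rewrite -subsetEset leEsub. Qed.

Lemma tensor_saturated (U : tensor f g) : saturated f g (tset U).
Proof. exact/asboolP/tsetP. Qed.

Lemma tset_le (U : tensor f g) p q :
  p.1 <= q.1 -> p.2 <= q.2 -> tset U q -> tset U p.
Proof.
have [u1 u2 _] := tensor_saturated U.
case: p q => [a b] [a' b'] /= aa' bb'.
have eA : a' = Vee [set x | x = a \/ x = a'].
  apply/le_anti/andP; split; first by apply: Vee_ub; right.
  by apply: Vee_le => x [->|->].
have eB : b' = Vee [set x | x = b \/ x = b'].
  apply/le_anti/andP; split; first by apply: Vee_ub; right.
  by apply: Vee_le => x [->|->].
rewrite eA u1 => /(_ a (or_introl erefl)).
by rewrite eB u2; apply; left.
Qed.

Lemma saturated_bigcap (P : set (set (A * B))) :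
  (forall U, P U -> saturated f g U) ->
  saturated f g [set p | forall U, P U -> U p].
Proof.
move=> sP; split=> [S b|a S|a c b] /=; split.
- by move=> h a Sa U PU; have [h1 _ _] := sP U PU; apply: (h1 S b).1 Sa; apply: h.
- move=> h U PU; have [h1 _ _] := sP U PU; apply/(h1 S b) => a Sa.
  exact: h PU.
- by move=> h b Sb U PU; have [_ h1 _] := sP U PU; apply: (h1 a S).1 Sb; apply: h.
- move=> h U PU; have [_ h1 _] := sP U PU; apply/(h1 a S) => b Sb.
  exact: h PU.
- by move=> h U PU; have [_ _ h1] := sP U PU; apply/h1; apply: h.
- by move=> h U PU; have [_ _ h1] := sP U PU; apply/h1; apply: h.
Qed.

Definition tclosure (X : set (A * B)) : tensor f g :=
  Tensor (asboolT (saturated_bigcap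
    (P := [set U | saturated f g U /\ (X `<=` U)%classic])
    (fun U h => h.1))).

Lemma tclosure_le (X : set (A * B)) (U : tensor f g) :
  tclosure X <= U <-> (X `<=` tset U)%classic.
Proof.
rewrite le_tensor; split=> h p Xp.
  by apply: h => V [_ XV]; apply: XV.
by apply: Xp; split=> //; apply: tensor_saturated.
Qed.

Lemma saturatedI (U V : tensor f g) :
  saturated f g (tset U `&` tset V)%classic.
Proof.
have [u1 u2 u3] := tensor_saturated U; have [v1 v2 v3] := tensor_saturated V.
split=> [S b|a S|a c b] /=.
- by rewrite /setI /= u1 v1; split=> [[h k] a Sa|h]; split=> *; apply h || auto.
- by rewrite /setI /= u2 v2; split=> [[h k] b Sb|h]; split=> *; apply h || auto.
- by rewrite /setI /= u3 v3.
Qed.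

Definition tmeet (U V : tensor f g) : tensor f g :=
  Tensor (asboolT (saturatedI U V)).

Definition tVee (S : set (tensor f g)) : tensor f g :=
  tclosure [set p | exists2 U, S U & tset U p].

Fact tle_meet (U V W : tensor f g) : (U <= tmeet V W) = (U <= V) && (U <= W).
Proof.
apply/idP/andP => [/le_tensor h|[/le_tensor h /le_tensor k]].
  by split; apply/le_tensor => p /h [].
by apply/le_tensor => p Up; split; [apply: h|apply: k].
Qed.

Fact tVee_ub (S : set (tensor f g)) U : S U -> U <= tVee S.
Proof.
move=> SU; apply/le_tensor => p Up V [_]; apply.
by exists U.
Qed.

Fact tVee_le (S : set (tensor f g)) V :
  (forall U, S U -> U <= V) -> tVee S <= V.
Proof.
move=> h; apply/tclosure_le => p [U SU Up].
exact: (le_tensor U V).1 (h U SU) _ Up.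
Qed.

End TensorFrame.

Lemma Vee_meetE (L : frameType) (x : L) (S : set L) :
  x `&` Vee S = Vee [set x `&` s | s in S].
Proof.
apply/le_anti/andP; split; first exact: meet_Vee_le.
apply: Vee_le => _ [s Ss <-]; rewrite lexI leIl /=.
exact/(le_trans (leIr _ _))/Vee_ub.
Qed.

Lemma Vee_meetEr (L : frameType) (x : L) (S : set L) :
  Vee S `&` x = Vee [set s `&` x | s in S].
Proof.
rewrite meetC Vee_meetE; congr Vee; apply/seteqP.
by split=> _ [s Ss <-]; exists s => //; rewrite meetC.
Qed.

Section TensorFrameLaw.
Variables (C A B : frameType) (f : C -> A) (g : C -> B).

Lemma saturated_shift (p : A * B) (V : tensor f g) :
  saturated f g [set q | tset V (p.1 `&` q.1, p.2 `&` q.2)].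
Proof.
have [v1 v2 v3] := tensor_saturated V.
split=> [S b|a S|a c b] /=.
- rewrite Vee_meetE v1; split=> [h a Sa|h _ [a Sa <-]]; last exact: h.
  by apply: h; exists a.
- rewrite Vee_meetE v2; split=> [h b Sb|h _ [b Sb <-]]; last exact: h.
  by apply: h; exists b.
- by rewrite meetA v3 meetCA.
Qed.

Definition tshift p V : tensor f g := Tensor (asboolT (saturated_shift p V)).

Fact tmeet_Vee_le (U : tensor f g) (S : set (tensor f g)) :
  tmeet U (tVee S) <= tVee [set tmeet U V | V in S].
Proof.
set W := (X in _ <= X).
apply/le_tensor => p [Up Sp].
have h : tVee S <= tshift p W.
  apply: tVee_le => V SV; apply/le_tensor => q Vq /=.
  have : tmeet U V <= W by apply: tVee_ub; exists V.
  move/le_tensor; apply; split.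
  - by apply: tset_le Up; rewrite /= leIl.
  - by apply: tset_le Vq; rewrite /= leIr.
have := (le_tensor _ _).1 h p Sp; rewrite /= !meetxx.
by rewrite -surjective_pairing.
Qed.

HB.instance Definition _ := POrder_isFrame.Build (tensor f g)
  (@tle_meet _ _ _ f g) (@tVee_ub _ _ _ f g) (@tVee_le _ _ _ f g)
  tmeet_Vee_le.

Definition pure (a : A) (b : B) : tensor f g := tclosure f g [set (a, b)].

(* The pullback in locales of the maps with inverse images f and g has frame
   [tensor f g]: [tpi1] and [tpi2] are the inverse images of its projections and
   [tpair p q] is the inverse image of the map into it induced by maps with
   inverse images p and q (see the lemmas below for the universal property). *)
Definition tpi1 (a : A) : tensor f g := pure a \top.
Definition tpi2 (b : B) : tensor f g := pure \top b.
Definition tpair (X : frameType) (p : A -> X) (q : B -> X)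
    (U : tensor f g) : X :=
  Vee [set p ab.1 `&` q ab.2 | ab in tset U].

Lemma pure_le a b (U : tensor f g) : pure a b <= U <-> tset U (a, b).
Proof. by rewrite tclosure_le; split=> [h|h _ ->//]; apply: h. Qed.

Lemma tset_pure a b : tset (pure a b) (a, b).
Proof. exact/pure_le. Qed.

Lemma tensor_Vee_pure (U : tensor f g) :
  U = Vee [set pure ab.1 ab.2 | ab in tset U].
Proof.
apply/le_anti/andP; split; last first.
  by apply: Vee_le => _ [[a b] Uab <-]; apply/pure_le.
apply/le_tensor => -[a b] Uab; apply/pure_le/Vee_ub.
by exists (a, b).
Qed.

Lemma tpi_square c : tpi1 (f c) = tpi2 (g c).
Proof.
have e (U : tensor f g) : tset U (f c, \top) <-> tset U (\top, g c).
  have [_ _ h] := tensor_saturated U.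
  by have := h \top c \top; rewrite meet1x meetx1.
apply/le_anti/andP; split; apply/pure_le.
  by apply: (e _).2; apply: tset_pure.
by apply: (e _).1; apply: tset_pure.
Qed.

Lemma tset_meet (U V : tensor f g) p :
  tset (U `&` V) p <-> tset U p /\ tset V p.
Proof. by split. Qed.

Lemma pure_meet a a' b b' :
  pure (a `&` a') (b `&` b') = pure a b `&` pure a' b'.
Proof.
apply/le_anti/andP; split.
  rewrite lexI; apply/andP; split; apply/pure_le.
    by apply: tset_le (@tset_pure a b); rewrite /= leIl.
  by apply: tset_le (@tset_pure a' b'); rewrite /= leIr.
set W := pure (a `&` a') _.
have h q : tset (pure a' b') q -> tset W (q.1 `&` a, q.2 `&` b).
  have i : pure a' b' <= tshift (a, b) W by apply/pure_le; apply: tset_pure.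
  by rewrite (meetC q.1) (meetC q.2) => /((le_tensor _ _).1 i q).
apply/le_tensor => q [qab /h Wq].
have i : pure a b <= tshift q W by apply/pure_le.
have := (le_tensor _ _).1 i q qab.
by rewrite /tset /= !meetxx -surjective_pairing.
Qed.

Lemma pure_Veel (S : set A) b : pure (Vee S) b = Vee [set pure a b | a in S].
Proof.
apply/le_anti/andP; split.
  apply/pure_le; have [h _ _] := tensor_saturated (Vee [set pure a b | a in S]).
  by apply/h => a Sa; apply/pure_le/Vee_ub; exists a.
apply: Vee_le => _ [a Sa <-]; apply/pure_le.
by apply: tset_le (@tset_pure _ _) => //=; apply: Vee_ub.
Qed.

Lemma pure_Veer a (S : set B) : pure a (Vee S) = Vee [set pure a b | b in S].
Proof.
apply/le_anti/andP; split.
  apply/pure_le; have [_ h _] := tensor_saturated (Vee [set pure a b | b in S]).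
  by apply/h => b Sb; apply/pure_le/Vee_ub; exists b.
apply: Vee_le => _ [b Sb <-]; apply/pure_le.
by apply: tset_le (@tset_pure _ _) => //=; apply: Vee_ub.
Qed.

Lemma pure_top : pure \top \top = \top.
Proof.
apply/le_anti; rewrite lex1 /=; apply/le_tensor => p _.
by apply: tset_le (@tset_pure _ _); rewrite /= lex1.
Qed.

Lemma tpi1_hom : frame_hom tpi1.
Proof.
split; first exact: pure_top.
  by move=> x y; rewrite /tpi1 -pure_meet meetxx.
by move=> S; apply: pure_Veel.
Qed.

Lemma tpi2_hom : frame_hom tpi2.
Proof.
split; first exact: pure_top.
  by move=> x y; rewrite /tpi2 -pure_meet meetxx.
by move=> S; apply: pure_Veer.
Qed.

Lemma pure_tpi a b : pure a b = tpi1 a `&` tpi2 b.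
Proof. by rewrite -pure_meet meetx1 meet1x. Qed.

Section Pairing.
Variables (X : frameType) (p : A -> X) (q : B -> X).
Hypotheses (hp : frame_hom p) (hq : frame_hom q).
Hypothesis pq : forall c, p (f c) = q (g c).

Lemma saturated_pair (x : X) :
  saturated f g [set ab | p ab.1 `&` q ab.2 <= x].
Proof.
split=> [S b|a S|a c b] /=.
- rewrite (fhom_Vee hp) Vee_meetEr; split=> [h a Sa|h].
    by apply: le_trans h; apply: Vee_ub; exists (p a) => //; exists a.
  by apply: Vee_le => _ [_ [a Sa <-] <-]; apply: h.
- rewrite (fhom_Vee hq) Vee_meetE; split=> [h b Sb|h].
    by apply: le_trans h; apply: Vee_ub; exists (q b) => //; exists b.
  by apply: Vee_le => _ [_ [b Sb <-] <-]; apply: h.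
- by rewrite (fhom_meet hp) (fhom_meet hq) pq meetA.
Qed.

Lemma tpair_adj (U : tensor f g) x :
  (tpair p q U <= x) = (U <= Tensor (asboolT (saturated_pair x))).
Proof.
apply/idP/idP => [h|/le_tensor h].
  by apply/le_tensor => ab Uab /=; apply: le_trans h; apply: Vee_ub; exists ab.
by apply: Vee_le => _ [ab Uab <-]; apply: h.
Qed.

Lemma tpair_pure a b : tpair p q (pure a b) = p a `&` q b.
Proof.
apply/le_anti/andP; split; last first.
  by apply: Vee_ub; exists (a, b) => //; apply: tset_pure.
by rewrite tpair_adj; apply/pure_le; apply: lexx.
Qed.

Lemma tpair_tpi1 a : tpair p q (tpi1 a) = p a.
Proof. by rewrite tpair_pure (fhom_top hq) meetx1. Qed.

Lemma tpair_tpi2 b : tpair p q (tpi2 b) = q b.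
Proof. by rewrite tpair_pure (fhom_top hp) meet1x. Qed.

Lemma tpair_hom : frame_hom (tpair p q).
Proof.
split.
- by rewrite -pure_top tpair_pure (fhom_top hp) (fhom_top hq) meetxx.
- move=> U V; apply/le_anti/andP; split.
    rewrite lexI; apply/andP; split; apply: Vee_le => _ [ab [Uab Vab] <-];
    by apply: Vee_ub; exists ab.
  rewrite Vee_meetEr; apply: Vee_le => _ [_ [ab Uab <-] <-].
  rewrite Vee_meetE; apply: Vee_le => _ [_ [cd Vcd <-] <-].
  rewrite meetACA -(fhom_meet hp) -(fhom_meet hq).
  apply: Vee_ub; exists (ab.1 `&` cd.1, ab.2 `&` cd.2) => //; split.
    by apply: tset_le Uab; rewrite /= leIl.
  by apply: tset_le Vcd; rewrite /= leIr.
- move=> S; apply/le_anti/andP; split.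
    rewrite tpair_adj; apply: Vee_le => U SU; rewrite -tpair_adj.
    by apply: Vee_ub; exists U.
  apply: Vee_le => _ [U SU <-]; rewrite tpair_adj.
  by rewrite (le_trans (Vee_ub S U SU)) // -tpair_adj.
Qed.

Lemma tpair_unique (h : tensor f g -> X) : frame_hom h ->
  (forall a, h (tpi1 a) = p a) -> (forall b, h (tpi2 b) = q b) ->
  h = tpair p q.
Proof.
move=> hh h1 h2; apply/funext => U.
rewrite [in LHS](tensor_Vee_pure U) (fhom_Vee hh) /tpair; congr Vee.
rewrite image_comp; apply: eq_imagel => ab _ /=.
by rewrite pure_tpi (fhom_meet hh) h1 h2.
Qed.

End Pairing.
End TensorFrameLaw.

(* The inverse images of the structure maps of an internal groupoid in locales:
   domain, range, units, inversion and multiplication, the locale of composable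
   pairs (x, y), r(x) = d(y), being the pullback of r and d. *)
Record groupoidData := GroupoidData {
  gd0 : frameType;
  gd1 : frameType;
  dS : gd0 -> gd1;
  rS : gd0 -> gd1;
  uS : gd1 -> gd0;
  iS : gd1 -> gd1;
  mS : gd1 -> tensor rS dS
}.

Section Groupoid.
Variable G : groupoidData.

(* Composable triples: the pullback of r o pi_2 : G_2 -> G_0 and d. *)
Definition triples : frameType :=
  tensor (fun z => tpi2 (rS (g := G)) (@dS G) (rS z)) (@dS G).

(* Inverse images of the maps (x, y, z) |-> (x y, z) and
   (x, y, z) |-> (x, y z) from composable triples to composable pairs. *)
Definition mul12S : tensor (@rS G) (@dS G) -> triples :=
  tpair (fun a => tpi1 _ _ (mS a)) (fun c => tpi2 _ _ c).
Definition mul23S : tensor (@rS G) (@dS G) -> triples :=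
  tpair (fun a => tpi1 _ _ (tpi1 _ _ a))
        (fun b => tpair (fun y => tpi1 _ _ (tpi2 _ _ y))
                        (fun z => tpi2 _ _ z) (mS b)).

Record localic_groupoid : Prop := {
  dS_hom : frame_hom (@dS G);
  rS_hom : frame_hom (@rS G);
  uS_hom : frame_hom (@uS G);
  iS_hom : frame_hom (@iS G);
  mS_hom : frame_hom (@mS G);
  lg_du : forall w, uS (dS w) = w :> gd0 G;
  lg_ru : forall w, uS (rS w) = w :> gd0 G;
  lg_dm : forall w, mS (dS w) = tpi1 _ _ (dS w) :> tensor (@rS G) (@dS G);
  lg_rm : forall w, mS (rS w) = tpi2 _ _ (rS w) :> tensor (@rS G) (@dS G);
  lg_assoc : forall a, mul12S (mS a) = mul23S (mS a);
  lg_unitl : forall a : gd1 G, tpair (fun x => dS (uS x)) id (mS a) = a;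
  lg_unitr : forall a : gd1 G, tpair id (fun x => rS (uS x)) (mS a) = a;
  lg_di : forall w, iS (dS w) = rS w :> gd1 G;
  lg_ri : forall w, iS (rS w) = dS w :> gd1 G;
  lg_invr : forall a : gd1 G, tpair id (@iS G) (mS a) = dS (uS a);
  lg_invl : forall a : gd1 G, tpair (@iS G) id (mS a) = rS (uS a)
}.

Definition quantal : Prop := semiopen (@mS G).

End Groupoid.

(* f0 and f1 are the inverse images of the object and arrow parts of an
   internal functor G -> H. *)
Record functorS (G H : groupoidData) (f0 : gd0 H -> gd0 G)
    (f1 : gd1 H -> gd1 G) : Prop := {
  functor0_hom : frame_hom f0;
  functor1_hom : frame_hom f1;
  functor_d : forall w, f1 (dS w) = dS (f0 w);
  functor_r : forall w, f1 (rS w) = rS (f0 w);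
  functor_u : forall a, f0 (uS a) = uS (f1 a);
  functor_i : forall a, f1 (iS a) = iS (f1 a);
  functor_m : forall a,
    tpair (fun x => tpi1 (@rS G) (@dS G) (f1 x)) (fun y => tpi2 _ _ (f1 y))
      (mS a) = mS (f1 a)
}.

Definition groupoid_iso (G H : groupoidData) : Prop :=
  exists f0 f1 g0 g1, [/\ @functorS G H f0 f1, @functorS H G g0 g1,
    cancel f0 g0 /\ cancel g0 f0 & cancel f1 g1 /\ cancel g1 f1].

(* Associativity and the laws of an involution are not part of this structure
   but of [involutive_quantal_frame]: the constructions R(Q), upsilon and G(Q)
   below do not use them, and the multiplication on O(G_1) defined by a localic
   groupoid whose multiplication map is semiopen need not be associative. *)
Record preQuantalFrame := PreQuantalFrame {
  qframe :> frameType;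
  qmul : qframe -> qframe -> qframe;
  qinv : qframe -> qframe;
  qmul_Veel : forall b, preserves_Vee (qmul^~ b);
  qmul_Veer : forall a, preserves_Vee (qmul a)
}.

Declare Scope quantale_scope.
Delimit Scope quantale_scope with Qu.
Notation "a * b" := (qmul a b) : quantale_scope.
Notation "a ^*" := (qinv a) : quantale_scope.
Local Open Scope quantale_scope.

Record involutive_quantal_frame (Q : preQuantalFrame) : Prop := {
  qmulA : associative (@qmul Q);
  qinvK : involutive (@qinv Q);
  qinvM : forall a b : Q, (a * b)^* = b^* * a^*;
  qinv_Vee : preserves_Vee (@qinv Q)
}.

Record quantale_hom (P Q : preQuantalFrame) (f : P -> Q) : Prop := {
  qhom_Vee : preserves_Vee f;
  qhom_mul : forall a b, f (a * b) = f a * f b;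
  qhom_inv : forall a, f a^* = (f a)^*
}.

Definition quantale_iso (P Q : preQuantalFrame) : Prop :=
  exists f g, [/\ @quantale_hom P Q f, @quantale_hom Q P g,
    cancel f g & cancel g f].

(* The elements of R(Q). *)
Record rightSided (Q : preQuantalFrame) := RightSided {
  rsval :> Q;
  rsvalP : rsval * \top <= rsval
}.

Section RightSided.
Variable Q : preQuantalFrame.
Local Notation R := (rightSided Q).

HB.instance Definition _ := [isSub of R for @rsval Q].
HB.instance Definition _ := [Choice of R by <:].
HB.instance Definition _ :=
  [SubChoice_isSubPOrder of R by <: with frame_display].

Lemma qmul_le2l (a b c : Q) : a <= b -> a * c <= b * c.
Proof.
move=> ab; have -> : b = Vee [set x | x = a \/ x = b].
  apply/le_anti/andP; split; first by apply: Vee_ub; right.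
  by apply: Vee_le => x [->|->].
by rewrite (qmul_Veel c); apply: Vee_ub; exists a => //; left.
Qed.

Fact rsmeetP (z w : R) : (rsval z `&` rsval w) * \top <= rsval z `&` rsval w.
Proof.
rewrite lexI; apply/andP; split.
  by apply: le_trans (rsvalP z); apply/qmul_le2l/leIl.
by apply: le_trans (rsvalP w); apply/qmul_le2l/leIr.
Qed.

Definition rsmeet z w : R := RightSided (rsmeetP z w).

Fact rsVeeP (S : set R) :
  Vee [set rsval z | z in S] * \top <= Vee [set rsval z | z in S].
Proof.
rewrite (qmul_Veel \top); apply: Vee_le => _ [_ [z Sz <-] <-].
by apply: (le_trans (rsvalP z)); apply: Vee_ub; exists z.
Qed.

Definition rsVee S : R := RightSided (rsVeeP S).

Fact rsle_meet (x y z : R) : (x <= rsmeet y z) = (x <= y) && (x <= z).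
Proof. by rewrite !leEsub lexI. Qed.

Fact rsVee_ub (S : set R) z : S z -> z <= rsVee S.
Proof. by move=> Sz; rewrite leEsub; apply: Vee_ub; exists z. Qed.

Fact rsVee_le (S : set R) y : (forall x, S x -> x <= y) -> rsVee S <= y.
Proof. by move=> h; rewrite leEsub; apply: Vee_le => _ [z Sz <-]; apply: h. Qed.

Fact rsmeet_Vee_le x (S : set R) :
  rsmeet x (rsVee S) <= rsVee [set rsmeet x s | s in S].
Proof.
rewrite leEsub /= Vee_meetE; apply: Vee_le => _ [_ [s Ss <-] <-].
by apply: Vee_ub; exists (rsmeet x s) => //; exists s.
Qed.

HB.instance Definition _ :=
  POrder_isFrame.Build R rsle_meet rsVee_ub rsVee_le rsmeet_Vee_le.

Definition tensorR : frameType :=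
  tensor (fun z : R => (rsval z)^*) (@rsval Q).

(* When the multiplication factors through Q (x)_{R(Q)} Q, this is the
   factorization: the join-preserving map sending a (x) b to a * b. *)
Definition mu0 (U : tensorR) : Q := Vee [set ab.1 * ab.2 | ab in tset U].

Definition balanced : Prop :=
  forall a b c : Q, b * (a * \top `&` c) = (b `&` \top * a^*) * c.

Definition multiplicative : Prop :=
  [/\ balanced, (forall a : Q, a * \top <= a <-> exists b, a = b * \top) &
      preserves_Vee (radj mu0)].

Definition upsilon (a : Q) : Q :=
  Vee [set xy.1 `&` xy.2 | xy in [set xy : Q * Q | xy.1 * xy.2^* <= a]].

Definition semiopen_quantal_frame : Prop :=
  [/\ balanced, (forall a, upsilon a * \top <= upsilon a) &
      forall a : Q, Vee [set x : Q | x * x^* * x <= a] = a].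

Definition multiplicative_semiopen_quantal_frame : Prop :=
  [/\ involutive_quantal_frame Q, multiplicative & semiopen_quantal_frame].

(* The groupoid G(Q).  Here [radj mu0] is the right adjoint of mu0, and
   [radj rsval (upsilon a)] is the greatest element of R(Q) below [upsilon a],
   hence [upsilon a] itself when upsilon takes its values in R(Q)
   (see [groupoid_of_u]). *)
Definition groupoid_of : groupoidData := {|
  gd0 := R;
  gd1 := Q;
  dS := @rsval Q;
  rS := fun z : R => (rsval z)^*;
  uS := fun a => radj (@rsval Q) (upsilon a);
  iS := @qinv Q;
  mS := radj mu0
|}.

Lemma groupoid_of_u a : upsilon a * \top <= upsilon a ->
  rsval (uS (g := groupoid_of) a) = upsilon a.
Proof.
move=> ua; apply/le_anti/andP; split.
  by apply: Vee_le => _ [z /= za <-].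
by apply: Vee_ub; exists (RightSided ua) => /=.
Qed.

End RightSided.

Section QuantaleOf.
Variables (G : groupoidData) (qG : quantal G).

(* [ladj (@mS G)] is m_!, and [pure a b] is the image of a (x) b in the frame
   of composable pairs. *)
Definition gmul (a b : gd1 G) : gd1 G := ladj (@mS G) (pure _ _ a b).

Lemma ladj_Vee (A B : frameType) (f : A -> B) :
  semiopen f -> preserves_Vee (ladj f).
Proof.
move=> [g adj] S; rewrite (ladj_unique adj); apply/le_anti/andP; split.
  by rewrite adj; apply: Vee_le => b Sb; rewrite -adj; apply: Vee_ub; exists b.
by apply: Vee_le => _ [b Sb <-]; rewrite adj (le_trans (Vee_ub S b Sb)) // -adj.
Qed.

Fact gmul_Veel b : preserves_Vee (gmul^~ b).
Proof. by move=> S; rewrite /gmul pure_Veel ladj_Vee // image_comp. Qed.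

Fact gmul_Veer a : preserves_Vee (gmul a).
Proof. by move=> S; rewrite /gmul pure_Veer ladj_Vee // image_comp. Qed.

Definition quantale_of : preQuantalFrame :=
  @PreQuantalFrame (gd1 G) gmul (ladj (@iS G)) gmul_Veel gmul_Veer.

End QuantaleOf.

(* Main.v *)
Require Import Defs.
From mathcomp Require Import all_boot all_order.
From mathcomp Require Import boolp classical_sets.

Set Implicit Arguments.
Unset Strict Implicit.
Unset Printing Implicit Defensive.

Import Order.LTheory.
Local Open Scope classical_set_scope.
Local Open Scope order_scope.
Local Open Scope quantale_scope.

(** The frame Q (x)_{R(Q)} Q is presented by saturated sets of pairs, and the
    inverse image of the multiplication of G(Q) sends a to the set of all
    pairs (x, y) with x y <= a.  Since [tpair p q U] is the join of
    p x /\ q y over the pairs in U, each axiom of a localic groupoid for G(Q)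
    becomes a statement about the products that lie below a.

    Half of the theorem is the verification of these axioms for a
    multiplicative semiopen quantal frame Q.  The work is done by the rule
    [cube_le]: x x^* x <= a implies x <= a.  It gives a <= a 1, whence the
    rules for the domain and the range of a product, and it turns the
    unit laws into estimates of cubes.  Associativity is that of Q, and the
    inverse laws hold because upsilon is by definition the composite of
    <id, i> with the multiplication.  The quantale of G(Q) is then Q itself:
    the left adjoint of the inverse image of the multiplication is [mu0],
    which sends a (x) b to a b, and the involution is its own adjoint.

    For the other half, let G be a localic groupoid with m semiopen and Q its
    quantale.  By adjunction x y <= a holds iff x (x) y <= m^* a, so G(Q)
    and G present m by the same saturated sets.  Writing a 1 <= a as
    pi_1^* a <= m^* a and pulling back along <id, i> and along <u d, id> gives
    a = d^* u^* a, so R(Q) is the image of d^*, hence a copy of O(G_0)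
    ([rightSidedE]); and the right inverse law says that
    upsilon = d^* u^*.  Thus d^* and the identity of O(G_1) form an
    isomorphism of all the data.  The axioms for G(Q) are carried over along
    it ([localic_groupoid_transport]), because the multiplication of Q is not
    known to be associative, so that the first half cannot be applied. *)

(** * Frames *)

Lemma preserves_Vee_le (A B : frameType) (f : A -> B) :
  preserves_Vee f -> {homo f : x y / x <= y}.
Proof.
move=> fV x y xy; have -> : y = Vee [set z | z = x \/ z = y].
  apply/le_anti/andP; split; first by apply: Vee_ub; right.
  by apply: Vee_le => z [->|->].
by rewrite fV; apply: Vee_ub; exists x => //; left.
Qed.

Lemma fhom_le (A B : frameType) (f : A -> B) :
  frame_hom f -> {homo f : x y / x <= y}.
Proof. by move=> hf; apply/preserves_Vee_le/fhom_Vee. Qed.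

Lemma frame_hom_id (A : frameType) : frame_hom (@id A).
Proof. by split=> // S; rewrite image_id. Qed.

Lemma frame_hom_comp (A B C : frameType) (g : B -> C) (f : A -> B) :
  frame_hom g -> frame_hom f -> frame_hom (fun x => g (f x)).
Proof.
move=> hg hf; split; first by rewrite (fhom_top hf) (fhom_top hg).
  by move=> x y; rewrite (fhom_meet hf) (fhom_meet hg).
by move=> S; rewrite (fhom_Vee hf) (fhom_Vee hg) image_comp.
Qed.

Lemma frame_hom_cancel_inj (A B C : frameType) (g : B -> C) (f : A -> B) :
  frame_hom g -> injective g -> frame_hom (fun x => g (f x)) -> frame_hom f.
Proof.
move=> hg ig hgf; split.
  by apply: ig; rewrite (fhom_top hgf) (fhom_top hg).
  by move=> x y; apply: ig; rewrite (fhom_meet hgf) (fhom_meet hg).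
by move=> S; apply: ig; rewrite (fhom_Vee hgf) (fhom_Vee hg) image_comp.
Qed.

Lemma rsval_hom (Q : preQuantalFrame) : frame_hom (@rsval Q).
Proof.
split=> //; apply/le_anti; rewrite lex1 /=.
have h : (\top : Q) * \top <= \top by rewrite lex1.
by have := lex1 (RightSided h : rightSided Q); rewrite leEsub.
Qed.

Lemma right_adjoint_frame_hom (A B : frameType) (g : B -> A) (f : A -> B) :
  left_adjoint g f -> preserves_Vee f -> frame_hom f.
Proof.
move=> adj fV; split=> // [|x y].
  by apply/le_anti; rewrite lex1 /= -adj lex1.
apply/le_anti/andP; split.
  by rewrite lexI !(preserves_Vee_le fV) ?leIl ?leIr.
by rewrite -adj lexI !adj leIl leIr.
Qed.

Lemma involutive_adjoint (A : frameType) (f : A -> A) :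
  involutive f -> preserves_Vee f -> left_adjoint f f.
Proof.
by move=> fK /preserves_Vee_le fle b a; apply/idP/idP => /fle; rewrite fK.
Qed.

Lemma tpair_comp (C A B X Y : frameType) (f : C -> A) (g : C -> B)
    (p : A -> X) (q : B -> X) (h : X -> Y) (U : tensor f g) :
  frame_hom h ->
  h (tpair p q U) = tpair (fun a => h (p a)) (fun b => h (q b)) U.
Proof.
move=> hh; rewrite /tpair (fhom_Vee hh) image_comp; congr Vee.
by apply: eq_imagel => ab _ /=; rewrite (fhom_meet hh).
Qed.

Lemma eq_tpair (C A B X : frameType) (f : C -> A) (g : C -> B)
    (p p' : A -> X) (q q' : B -> X) (U : tensor f g) :
  p =1 p' -> q =1 q' -> tpair p q U = tpair p' q' U.
Proof. by move=> /funext -> /funext ->. Qed.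

(** Tensor products over different frames have different types, but their
    elements can be compared through the sets of pairs that represent them. *)
Lemma tpair_tset (C C' A B X : frameType) (f : C -> A) (g : C -> B)
    (f' : C' -> A) (g' : C' -> B) (p : A -> X) (q : B -> X)
    (U : tensor f g) (V : tensor f' g') :
  tset U = tset V -> tpair p q U = tpair p q V.
Proof. by rewrite /tpair => ->. Qed.

Lemma tpair_tpi (C A B : frameType) (f : C -> A) (g : C -> B) (U : tensor f g) :
  tpair (tpi1 f g) (tpi2 f g) U = U.
Proof.
rewrite [RHS]tensor_Vee_pure; congr Vee.
by apply: eq_imagel => ab _; rewrite pure_tpi.
Qed.

(** * Transport of groupoids along isomorphisms *)

Local Notation tpi_first G :=
  (tpi1 (fun z => tpi2 (rS (g := G)) (@dS G) (rS z)) (@dS G)).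
Local Notation tpi_last G :=
  (tpi2 (fun z => tpi2 (rS (g := G)) (@dS G) (rS z)) (@dS G)).

Section Triples.
Variable G : groupoidData.

(** The inverse image of (x, y, z) |-> (y, z), which [mul23S] composes with
    the multiplication. *)
Definition pair23 : tensor (@rS G) (@dS G) -> triples G :=
  tpair (fun y => tpi1 _ _ (tpi2 _ _ y)) (fun z => tpi2 _ _ z).

Lemma triples_square w :
  tpi_first G (tpi2 _ _ (rS w)) = tpi_last G (dS w).
Proof. exact: (tpi_square (fun z => tpi2 (rS (g := G)) (@dS G) (rS z))). Qed.

Definition tpi12_hom := frame_hom_comp
  (tpi1_hom (fun z => tpi2 (rS (g := G)) (@dS G) (rS z)) (@dS G))
  (tpi2_hom (@rS G) (@dS G)).

Definition tpi11_hom := frame_hom_comp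
  (tpi1_hom (fun z => tpi2 (rS (g := G)) (@dS G) (rS z)) (@dS G))
  (tpi1_hom (@rS G) (@dS G)).

Definition tpi3_hom :=
  tpi2_hom (fun z => tpi2 (rS (g := G)) (@dS G) (rS z)) (@dS G).

Lemma tpi_assoc x y z :
  tpi_first G (pure _ _ x y) `&` tpi_last G z =
  tpi_first G (tpi1 _ _ x) `&` (tpi_first G (tpi2 _ _ y) `&` tpi_last G z).
Proof. by rewrite pure_tpi (fhom_meet (tpi1_hom _ _)) meetA. Qed.

Lemma pair23_hom : frame_hom pair23.
Proof. exact: tpair_hom tpi12_hom tpi3_hom triples_square. Qed.

Lemma pair23_tpi1 a : pair23 (tpi1 _ _ a) = tpi1 _ _ (tpi2 _ _ a).
Proof. exact: tpair_tpi1 tpi12_hom tpi3_hom triples_square _. Qed.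

End Triples.

Section Transport.
Variables (G H : groupoidData).
Variables (f0 : gd0 G -> gd0 H) (f1 : gd1 G -> gd1 H).
Variables (g0 : gd0 H -> gd0 G) (g1 : gd1 H -> gd1 G).
Hypotheses (lgG : localic_groupoid G) (hf : @functorS H G f0 f1).
Hypotheses (hg0 : frame_hom g0) (hg1 : frame_hom g1).
Hypothesis gK0 : cancel g0 f0.
Hypotheses (fK1 : cancel f1 g1) (gK1 : cancel g1 f1).

Let hf0 := functor0_hom hf.
Let hf1 := functor1_hom hf.

Let dE w : dS w = f1 (dS (g0 w)). Proof. by rewrite (functor_d hf) gK0. Qed.
Let rE w : rS w = f1 (rS (g0 w)). Proof. by rewrite (functor_r hf) gK0. Qed.
Let uE a : uS a = f0 (uS (g1 a)). Proof. by rewrite (functor_u hf) gK1. Qed.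
Let iE a : iS a = f1 (iS (g1 a)). Proof. by rewrite (functor_i hf) gK1. Qed.

(** The maps of composable pairs and triples induced by the functor; every
    structure map of [H] is the corresponding one of [G] conjugated by these,
    so each axiom of [H] is the image of that axiom of [G]. *)
Let pairs : tensor (@rS G) (@dS G) -> tensor (@rS H) (@dS H) :=
  tpair (fun x => tpi1 _ _ (f1 x)) (fun y => tpi2 _ _ (f1 y)).

Let mE a : mS a = pairs (mS (g1 a)).
Proof. by rewrite /pairs (functor_m hf) gK1. Qed.

Let p1_hom := frame_hom_comp (tpi1_hom (@rS H) (@dS H)) hf1.
Let p2_hom := frame_hom_comp (tpi2_hom (@rS H) (@dS H)) hf1.

Let p12 w : tpi1 (@rS H) (@dS H) (f1 (rS w)) = tpi2 _ _ (f1 (dS w)).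
Proof. by rewrite (functor_r hf) (functor_d hf) tpi_square. Qed.

Let pairs_hom : frame_hom pairs.
Proof. exact: tpair_hom p1_hom p2_hom p12. Qed.

Let tpair_pairs (X : frameType) (p q : gd1 H -> X) U :
  frame_hom p -> frame_hom q -> (forall w, p (rS w) = q (dS w)) ->
  tpair p q (pairs U) = tpair (fun x => p (f1 x)) (fun y => q (f1 y)) U.
Proof.
move=> hp hq pq; rewrite /pairs tpair_comp; last exact: tpair_hom.
by apply: eq_tpair => a /=; [rewrite tpair_tpi1|rewrite tpair_tpi2].
Qed.

Let triplesE w :
  tpi_first H (pairs (tpi2 _ _ (rS w))) = tpi_last H (f1 (dS w)).
Proof.
rewrite /pairs (tpair_tpi2 p1_hom p2_hom p12) (functor_r hf) (functor_d hf).
by rewrite -tpi_square.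
Qed.

Let triples_map : triples G -> triples H :=
  tpair (fun U => tpi1 _ _ (pairs U)) (fun y => tpi2 _ _ (f1 y)).

Let t1_hom := frame_hom_comp
  (tpi1_hom (fun z => tpi2 (rS (g := H)) (@dS H) (rS z)) (@dS H)) pairs_hom.
Let t2_hom := frame_hom_comp
  (tpi2_hom (fun z => tpi2 (rS (g := H)) (@dS H) (rS z)) (@dS H)) hf1.

Let triples_map_hom : frame_hom triples_map.
Proof. exact: tpair_hom t1_hom t2_hom triplesE. Qed.
Let dS_homH : frame_hom (@dS H).
Proof.
rewrite (funext dE).
exact: frame_hom_comp hf1 (frame_hom_comp (dS_hom lgG) hg0).
Qed.
Let rS_homH : frame_hom (@rS H).
Proof.
rewrite (funext rE).
exact: frame_hom_comp hf1 (frame_hom_comp (rS_hom lgG) hg0).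
Qed.
Let uS_homH : frame_hom (@uS H).
Proof.
rewrite (funext uE).
exact: frame_hom_comp hf0 (frame_hom_comp (uS_hom lgG) hg1).
Qed.
Let iS_homH : frame_hom (@iS H).
Proof.
rewrite (funext iE).
exact: frame_hom_comp hf1 (frame_hom_comp (iS_hom lgG) hg1).
Qed.
Let mS_homH : frame_hom (@mS H).
Proof.
rewrite (funext mE).
exact: frame_hom_comp pairs_hom (frame_hom_comp (mS_hom lgG) hg1).
Qed.
Let duH w : uS (dS w) = w :> gd0 H.
Proof. by rewrite uE dE fK1 (lg_du lgG) gK0. Qed.
Let ruH w : uS (rS w) = w :> gd0 H.
Proof. by rewrite uE rE fK1 (lg_ru lgG) gK0. Qed.
Let dmH w : mS (dS w) = tpi1 _ _ (dS w) :> tensor (@rS H) (@dS H).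
Proof.
by rewrite mE dE fK1 (lg_dm lgG) /pairs (tpair_tpi1 p1_hom p2_hom p12).
Qed.
Let rmH w : mS (rS w) = tpi2 _ _ (rS w) :> tensor (@rS H) (@dS H).
Proof.
by rewrite mE rE fK1 (lg_rm lgG) /pairs (tpair_tpi2 p1_hom p2_hom p12).
Qed.

Let triples_map_tpi1 U :
  triples_map (tpi1 _ _ U) = tpi1 _ _ (pairs U).
Proof. by rewrite /triples_map (tpair_tpi1 t1_hom t2_hom triplesE). Qed.

Let triples_map_tpi2 y :
  triples_map (tpi2 _ _ y) = tpi2 _ _ (f1 y).
Proof. by rewrite /triples_map (tpair_tpi2 t1_hom t2_hom triplesE). Qed.

Let mul12E U : mul12S (pairs U) = triples_map (mul12S U).
Proof.
rewrite /mul12S tpair_pairs.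
- rewrite tpair_comp //; apply: eq_tpair => x.
    by rewrite mE fK1 triples_map_tpi1.
  by rewrite triples_map_tpi2.
- exact: frame_hom_comp (tpi1_hom _ _) mS_homH.
- exact: tpi2_hom.
- by move=> w; rewrite rmH triples_square.
Qed.

Let pair23E U : pair23 (pairs U) = triples_map (pair23 U).
Proof.
rewrite {1}/pair23 tpair_pairs.
- rewrite /pair23 tpair_comp //; apply: eq_tpair => x.
    by rewrite triples_map_tpi1 /pairs (tpair_tpi2 p1_hom p2_hom p12).
  by rewrite triples_map_tpi2.
- exact: tpi12_hom.
- exact: tpi3_hom.
- exact: triples_square.
Qed.

Let mul23E U : mul23S (pairs U) = triples_map (mul23S U).
Proof.
rewrite /mul23S tpair_pairs.
- rewrite tpair_comp //; apply: eq_tpair => x.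
    by rewrite triples_map_tpi1 /pairs (tpair_tpi1 p1_hom p2_hom p12).
  by rewrite mE fK1 -/(pair23 _) pair23E.
- exact: tpi11_hom.
- exact: frame_hom_comp (@pair23_hom H) mS_homH.
- by move=> w; rewrite dmH -/(pair23 _) pair23_tpi1 tpi_square.
Qed.

Let diH w : iS (dS w) = rS w :> gd1 H.
Proof. by rewrite iE dE fK1 (lg_di lgG) -rE. Qed.
Let riH w : iS (rS w) = dS w :> gd1 H.
Proof. by rewrite iE rE fK1 (lg_ri lgG) -dE. Qed.

(** As [f] is bijective, its compatibility with the structure maps determines
    those of [H]. *)
Lemma localic_groupoid_transport : localic_groupoid H.
Proof.
split=> //.
- by move=> a; rewrite mE mul12E mul23E (lg_assoc lgG).
- move=> a; rewrite mE tpair_pairs.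
  + rewrite -[RHS]gK1 -[in RHS](lg_unitl lgG (g1 a)) tpair_comp //.
    by apply: eq_tpair => x //; rewrite uE fK1 (functor_d hf).
  + exact: frame_hom_comp dS_homH uS_homH.
  + exact: frame_hom_id.
  + by move=> w; rewrite ruH.
- move=> a; rewrite mE tpair_pairs.
  + rewrite -[RHS]gK1 -[in RHS](lg_unitr lgG (g1 a)) tpair_comp //.
    by apply: eq_tpair => x //; rewrite uE fK1 (functor_r hf).
  + exact: frame_hom_id.
  + exact: frame_hom_comp rS_homH uS_homH.
  + by move=> w; rewrite duH.
- move=> a; rewrite mE tpair_pairs //.
  + rewrite uE -(functor_d hf) -(lg_invr lgG) tpair_comp //.
    by apply: eq_tpair => x //; rewrite iE fK1.
  + exact: frame_hom_id.
- move=> a; rewrite mE tpair_pairs //.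
  + rewrite uE -(functor_r hf) -(lg_invl lgG) tpair_comp //.
    by apply: eq_tpair => x //; rewrite iE fK1.
  + exact: frame_hom_id.
Qed.

End Transport.

(** * Inversion is an involution *)

Section InvolutiveInverse.
Variables (G : groupoidData) (lgG : localic_groupoid G).

Let iihom := frame_hom_comp (iS_hom lgG) (iS_hom lgG).
Let iid w : iS (iS (dS w)) = dS w :> gd1 G.
Proof. by rewrite (lg_di lgG) (lg_ri lgG). Qed.
Let idi w : id (rS w) = iS (dS w) :> gd1 G.
Proof. by rewrite (lg_di lgG). Qed.
Let id1 := @frame_hom_id (gd1 G).

(** The inverse images of the maps x |-> (x, x^-1) and
    x |-> (x, x^-1, (x^-1)^-1). *)
Let xi : tensor (@rS G) (@dS G) -> gd1 G := tpair id (@iS G).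
Let xi_hom : frame_hom xi. Proof. exact: tpair_hom (iS_hom lgG) idi. Qed.

Let xii : triples G -> gd1 G := tpair xi (fun a => iS (iS a)).
Let xii_sq w : xi (tpi2 _ _ (rS w)) = iS (iS (dS w)).
Proof. by rewrite /xi (tpair_tpi2 id1 (iS_hom lgG) idi) (lg_ri lgG) iid. Qed.
Let xii_hom : frame_hom xii.
Proof. exact: tpair_hom xi_hom iihom xii_sq. Qed.
Let xii_tpi1 U : xii (tpi1 _ _ U) = xi U.
Proof. exact: tpair_tpi1 xi_hom iihom xii_sq _. Qed.
Let xii_tpi2 U : xii (tpi2 _ _ U) = iS (iS U).
Proof. exact: tpair_tpi2 xi_hom iihom xii_sq _. Qed.

(** The triple product x x^-1 (x^-1)^-1 equals (x^-1)^-1 when it is bracketed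
    to the left, and x when it is bracketed to the right. *)
Lemma iS_involutive : involutive (@iS G).
Proof.
move=> a.
have e1 : xii (mul12S (mS a)) = iS (iS a).
  rewrite -[in RHS](lg_unitl lgG a) (tpair_comp _ _ _ iihom).
  rewrite /mul12S (tpair_comp _ _ _ xii_hom).
  apply: eq_tpair => x.
    by rewrite xii_tpi1 /xi (lg_invr lgG) iid.
  by rewrite xii_tpi2.
have e2 : xii (mul23S (mS a)) = a.
  rewrite -[RHS](lg_unitr lgG a) /mul23S (tpair_comp _ _ _ xii_hom).
  apply: eq_tpair => x.
    by rewrite xii_tpi1 /xi (tpair_tpi1 id1 (iS_hom lgG) idi).
  rewrite (tpair_comp _ _ _ xii_hom) -(lg_di lgG) -(lg_invr lgG).
  rewrite (tpair_comp _ _ _ (iS_hom lgG)); apply: eq_tpair => y.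
    by rewrite xii_tpi1 /xi (tpair_tpi2 id1 (iS_hom lgG) idi).
  exact: xii_tpi2.
by rewrite -e1 (lg_assoc lgG) e2.
Qed.

End InvolutiveInverse.

(** * The right adjoint of the multiplication *)

(** Saturation says that the multiplication factors through
    Q (x)_{R(Q)} Q.  For a multiplicative Q this is the balance law; for the
    quantale of a groupoid, the pairs with x y <= c form the saturated set
    m^* c. *)
Section Mul.
Variable Q : preQuantalFrame.
Hypothesis sat : forall c : Q,
  saturated (fun z : rightSided Q => (rsval z)^*) (@rsval Q)
    [set xy | xy.1 * xy.2 <= c].

Definition mul_le_set c : tensorR Q := Tensor (asboolT (sat c)).

Lemma mu0_adj : left_adjoint (@mu0 Q) mul_le_set.
Proof.
move=> U c; apply/idP/idP => [h|/le_tensor h].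
  by apply/le_tensor => xy Uxy /=; apply: le_trans h; apply: Vee_ub; exists xy.
by apply: Vee_le => _ [xy /h Uxy <-].
Qed.

Lemma radj_mu0 c : tset (radj (@mu0 Q) c) = [set xy | xy.1 * xy.2 <= c].
Proof. by rewrite (radj_unique mu0_adj). Qed.

(** With the substitution of y^* for y, the definition of upsilon becomes the
    pullback of the multiplication along x |-> (x, x^-1). *)
Lemma upsilon_tpair a : involutive (@qinv Q) ->
  upsilon a = tpair id (@qinv Q) (radj (@mu0 Q) a).
Proof.
move=> iK; rewrite /tpair radj_mu0; congr Vee; apply/seteqP; split.
  by move=> _ [[x y] /= h <-]; exists (x, y^*); rewrite /= ?iK.
by move=> _ [[x y] /= h <-]; exists (x, y^*); rewrite /= ?iK.
Qed.
End Mul.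

(** * The groupoid of a multiplicative semiopen quantal frame *)

Section GroupoidOfQuantalFrame.
Variable Q : preQuantalFrame.
Hypothesis hQ : multiplicative_semiopen_quantal_frame Q.

Let iqf : involutive_quantal_frame Q. Proof. by have [] := hQ. Qed.
Let bal : balanced Q. Proof. by have [_ []] := hQ. Qed.
Let MV : preserves_Vee (radj (@mu0 Q)). Proof. by have [_ []] := hQ. Qed.
Let RQ a : a * \top <= a <-> exists b : Q, a = b * \top.
Proof. by have [_ []] := hQ. Qed.
Let upsR a : upsilon a * \top <= upsilon a :> Q.
Proof. by have [_ _ []] := hQ. Qed.

Local Notation R := (rightSided Q).
Local Notation inv := (@qinv Q).
Local Notation M := (radj (@mu0 Q)).

Lemma cube_le (x a : Q) : x * x^* * x <= a -> x <= a.
Proof.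
by move=> h; have [_ _ [_ _ e]] := hQ; rewrite -(e a); apply: Vee_ub.
Qed.

Let iK : involutive inv := qinvK iqf.

Let inv_adj : left_adjoint inv inv.
Proof. exact: involutive_adjoint iK (qinv_Vee iqf). Qed.

Let inv_hom : frame_hom inv.
Proof. exact: right_adjoint_frame_hom inv_adj (qinv_Vee iqf). Qed.

Lemma inv_le (x y : Q) : (x^* <= y) = (x <= y^*).
Proof. exact: inv_adj. Qed.

Lemma qmul_le (a b c d : Q) : a <= b -> c <= d -> a * c <= b * d.
Proof.
move=> ab cd; apply: (le_trans (qmul_le2l _ ab)).
exact: preserves_Vee_le (qmul_Veer b) _ _ cd.
Qed.

(** The balance law in terms of R(Q): every right-sided z is of the form a 1,
    and then z^* = 1 a^*. *)
Lemma balanced_rightSided (x y : Q) (z : R) :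
  x * (rsval z `&` y) = (x `&` (rsval z)^*) * y.
Proof.
have /RQ[b ->] := rsvalP z.
by rewrite bal (qinvM iqf) (fhom_top inv_hom).
Qed.

Let sat (c : Q) : saturated (fun z : R => (rsval z)^*) (@rsval Q)
  [set xy | xy.1 * xy.2 <= c].
Proof.
split=> [S b|a S|a z b] /=.
- rewrite (qmul_Veel b); split=> [h a Sa|h].
    by apply: le_trans h; apply: Vee_ub; exists a.
  by apply: Vee_le => _ [a Sa <-]; apply: h.
- rewrite (qmul_Veer a); split=> [h b Sb|h].
    by apply: le_trans h; apply: Vee_ub; exists b.
  by apply: Vee_le => _ [b Sb <-]; apply: h.
- by rewrite balanced_rightSided.
Qed.

Let ME a : tset (M a) = [set xy | xy.1 * xy.2 <= a].
Proof. exact: radj_mu0. Qed.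

Let tpair_ub (X : frameType) (p q : Q -> X) (a x y : Q) :
  x * y <= a -> p x `&` q y <= tpair p q (M a).
Proof. by move=> h; apply: Vee_ub; exists (x, y); rewrite // ME. Qed.

Let tpair_lub (X : frameType) (p q : Q -> X) (a : Q) (b : X) :
  (forall x y, x * y <= a -> p x `&` q y <= b) -> tpair p q (M a) <= b.
Proof. by move=> h; apply: Vee_le => z [[x y]]; rewrite ME => /h ? <-. Qed.

Let M_adj : left_adjoint (@mu0 Q) M.
Proof. by rewrite (radj_unique (mu0_adj sat)); exact: mu0_adj. Qed.

Let M_hom : frame_hom M.
Proof. exact: right_adjoint_frame_hom M_adj MV. Qed.

Let ups (a : Q) : upsilon a = tpair id inv (M a).
Proof. exact: upsilon_tpair. Qed.

Let rS_homQ : frame_hom (fun z : R => (rsval z)^*).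
Proof. exact: frame_hom_comp inv_hom (@rsval_hom Q). Qed.

Let uE a : rsval (uS (g := groupoid_of Q) a) = upsilon a.
Proof. exact: groupoid_of_u. Qed.

Let upsilon_hom : frame_hom (@upsilon Q).
Proof.
rewrite (funext ups); apply: frame_hom_comp M_hom.
by apply: tpair_hom inv_hom _; first exact: frame_hom_id.
Qed.

(** Since a a^* a <= a 1. *)
Lemma le_mul_top (a : Q) : a <= a * \top.
Proof. by apply: cube_le; rewrite -(qmulA iqf) qmul_le // lex1.
Qed.

Lemma le_top_mul (a : Q) : a <= \top * a.
Proof.
by rewrite -{1}(iK a) inv_le (qinvM iqf) (fhom_top inv_hom) le_mul_top.
Qed.

Lemma meet_mul_inv_le (x y a : Q) : x * y^* <= a ->
  (x `&` y) * (x `&` y)^* <= a.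
Proof.
by apply/le_trans/qmul_le; rewrite ?leIl // (fhom_le inv_hom) // leIr.
Qed.

(** If x y^* <= z then t = x /\ y satisfies t t^* t <= z t <= z 1 <= z, and so
    t <= z. *)
Lemma upsilon_rightSided (z : R) : upsilon (rsval z) = rsval z.
Proof.
apply/le_anti/andP; split; last first.
  apply: Vee_ub; exists (rsval z, \top); rewrite /= ?meetx1 //.
  exact/(le_trans _ (rsvalP z))/qmul_le.
apply: Vee_le => _ [[x y] /= /meet_mul_inv_le h <-].
apply/cube_le/(le_trans (qmul_le2l _ h))/(le_trans _ (rsvalP z)).
by rewrite qmul_le // lex1.
Qed.

Let upsilon_inv (a : Q) : upsilon a^* = upsilon a.
Proof.
congr Vee; apply/seteqP; split=> _ [[x y] /= h <-];
  exists (y, x); rewrite /= 1?meetC //.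
  by rewrite -inv_le (qinvM iqf) iK in h.
by rewrite -inv_le (qinvM iqf) iK.
Qed.

Let mul_top_rs (a : Q) : (a * \top) * \top <= a * \top.
Proof. by rewrite -(qmulA iqf) qmul_le // lex1. Qed.

Let pure_le_M (x y : Q) : pure _ _ x y <= M (x * y).
Proof. by apply/pure_le; rewrite ME /=. Qed.

(** The domain of a product is the domain of its first factor.  If x y <= z,
    then x may be replaced in x (x) y by x' = x /\ (y 1)^*, because
    y <= y 1 and y 1 acts on both sides of the tensor product; and
    x' <= x' 1 = x y 1 <= z 1 <= z by the balance law. *)
Lemma radj_mu0_rightSided (z : R) : M (rsval z) = tpi1 _ _ (rsval z).
Proof.
apply/le_anti/andP; split; last first.
  by apply/pure_le; rewrite ME; exact: rsvalP.
apply/le_tensor => -[x y]; rewrite ME => xyz.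
have [_ _ u3] := tensor_saturated
  (pure (fun z : R => (rsval z)^*) (@rsval Q) (rsval z) \top).
pose w : R := RightSided (mul_top_rs y).
rewrite -(meet_r (le_mul_top y)) -/(rsval w).
apply/(u3 x w y); apply: tset_le (@tset_pure _ _ _ _ _ _ _) => /=;
  last exact: lex1.
apply: (le_trans (le_mul_top _)).
rewrite -(balanced_rightSided x \top w) /= meetx1 (qmulA iqf).
apply: le_trans (rsvalP z).
exact: qmul_le.
Qed.

(** The mirror image: in x (x) y the factor y may be replaced by
    x^* 1 /\ y, as x <= 1 x = (x^* 1)^*. *)
Lemma radj_mu0_rightSided_inv (z : R) : M (rsval z)^* = tpi2 _ _ (rsval z)^*.
Proof.
apply/le_anti/andP; split; last first.
  apply/pure_le; rewrite ME /= -inv_le (qinvM iqf) iK (fhom_top inv_hom).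
  exact: rsvalP.
apply/le_tensor => -[x y]; rewrite ME => xyz.
have [_ _ u3] := tensor_saturated
  (pure (fun z : R => (rsval z)^*) (@rsval Q) \top (rsval z)^*).
pose w : R := RightSided (mul_top_rs x^*).
have wE : (rsval w)^* = \top * x.
  by rewrite /= (qinvM iqf) iK (fhom_top inv_hom).
rewrite -(meet_l (le_top_mul x)) -wE.
apply/(u3 x w y); apply: tset_le (@tset_pure _ _ _ _ _ _ _) => /=;
  first exact: lex1.
apply: (le_trans (le_top_mul _)); rewrite (balanced_rightSided _ _ w) meet1x wE.
rewrite -(qmulA iqf) -inv_le (qinvM iqf) (fhom_top inv_hom).
by apply: le_trans (rsvalP z); rewrite qmul_le // inv_le.
Qed.

(** Both sides are the join of the x (x) y (x) z with x y z <= a. *)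
Lemma radj_mu0_assoc (a : Q) :
  mul12S (G := groupoid_of Q) (M a) = mul23S (G := groupoid_of Q) (M a).
Proof.
apply/le_anti/andP; split.
  apply: tpair_lub => x y xya; rewrite -pure_tpi; apply/pure_le.
  set W := mul23S _; have [w1 _ _] := tensor_saturated W.
  rewrite [mS _]tensor_Vee_pure; apply/w1 => _ [[s t] + <-].
  rewrite ME => stx; apply/pure_le; rewrite pure_tpi tpi_assoc.
  have h : s * (t * y) <= a.
    by rewrite (qmulA iqf); apply: le_trans xya; exact: qmul_le.
  apply: le_trans (tpair_ub _ _ h); apply: leI2 => //.
  exact: (tpair_ub _ _ (lexx (t * y))).
apply: tpair_lub => x y xya; rewrite [X in _ `&` X <= _]/tpair Vee_meetE.
apply: Vee_le => _ [_ [[s t] + <-] <-]; rewrite ME /= => sty.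
rewrite -(tpi_assoc (G := groupoid_of Q)).
have h : (x * s) * t <= a.
  by rewrite -(qmulA iqf); apply: le_trans xya; exact: qmul_le.
apply: le_trans (tpair_ub _ _ h); apply: leI2 => //.
exact: (fhom_le (tpi1_hom _ _)) (pure_le_M x s).
Qed.

(** For the upper bound, the meet p of s, t and y, where s t^* <= x and
    x y <= a, satisfies p p^* p <= s t^* y <= a.  For the lower bound, a is
    the join of the x with x x^* x <= a, and each of them is below
    upsilon (x x^* ) /\ x. *)
Lemma upsilon_unitl (a : Q) : tpair (@upsilon Q) id (M a) = a.
Proof.
apply/le_anti/andP; split.
  apply: tpair_lub => x y xya; rewrite Vee_meetEr.
  apply: Vee_le => _ [_ [[s t] /= stx <-] <-]; apply: cube_le.
  apply: le_trans xya; apply: qmul_le; last exact: leIr.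
  apply: le_trans stx; apply: qmul_le; first by rewrite -meetA leIl.
  by rewrite (fhom_le inv_hom) // meetAC leIr.
have [_ _ [_ _ e]] := hQ; rewrite -{1}(e a); apply: Vee_le => x /= xa.
apply: le_trans (tpair_ub _ _ xa); rewrite lexI lexx andbT.
by apply: Vee_ub; exists (x, x); rewrite //= meetxx.
Qed.

Lemma upsilon_unitr (a : Q) : tpair id (fun x => (upsilon x)^*) (M a) = a.
Proof.
apply: (inv_inj iK); rewrite tpair_comp // -[RHS]upsilon_unitl /tpair !ME.
congr Vee; apply/seteqP; split=> _ [[x y] /= xya <-]; exists (y^*, x^*).
- by rewrite /= -(qinvM iqf) (fhom_le inv_hom).
- by rewrite /= upsilon_inv iK meetC.
- by rewrite /= -(qinvM iqf) inv_le.
- by rewrite /= upsilon_inv !iK meetC.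
Qed.

Lemma groupoid_of_localic : localic_groupoid (groupoid_of Q).
Proof.
split.
- exact: rsval_hom.
- exact: rS_homQ.
- apply: (frame_hom_cancel_inj (@rsval_hom Q) val_inj).
  by rewrite (funext uE).
- exact: inv_hom.
- exact: M_hom.
- by move=> w; apply: val_inj; rewrite [LHS]uE upsilon_rightSided.
- move=> w; apply: val_inj.
  by rewrite [LHS]uE /= upsilon_inv upsilon_rightSided.
- exact: radj_mu0_rightSided.
- exact: radj_mu0_rightSided_inv.
- exact: radj_mu0_assoc.
- by move=> a; rewrite -[RHS]upsilon_unitl; apply: eq_tpair => // x; exact: uE.
- move=> a; rewrite -[RHS]upsilon_unitr.
  by apply: eq_tpair => // x; rewrite -uE.
- by [].
- by move=> w; exact: iK.
- by move=> a; rewrite [RHS]uE ups.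
- move=> a; rewrite [RHS](congr1 inv (uE a)) ups (tpair_comp _ _ _ inv_hom).
  by apply: eq_tpair => // x; rewrite iK.
Qed.

Lemma groupoid_of_quantal : quantal (groupoid_of Q).
Proof. by exists (@mu0 Q). Qed.

Lemma quantale_of_groupoid_of (qQ : quantal (groupoid_of Q)) :
  quantale_iso (quantale_of qQ) Q.
Proof.
have mulE (a b : Q) : gmul (G := groupoid_of Q) a b = a * b.
  rewrite /gmul (ladj_unique M_adj); apply/le_anti/andP; split.
    by rewrite M_adj.
  by apply: Vee_ub; exists (a, b); first exact: @tset_pure _ _ _ _ _ _ _.
have invE : ladj inv = inv by exact: ladj_unique.
exists id, id; split=> //; split=> //=.
- by move=> S; rewrite image_id.
- by move=> a; rewrite invE.
- by move=> S; rewrite image_id.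
- by move=> a; rewrite invE.
Qed.
End GroupoidOfQuantalFrame.

(** * The quantale of a quantal groupoid *)

Section QuantaleOfGroupoid.
Variable G : groupoidData.
Hypotheses (lgG : localic_groupoid G) (qG : quantal G).
Local Notation Q := (quantale_of qG).
Local Notation R := (rightSided Q).

Let m_adj : left_adjoint (ladj (@mS G)) (@mS G).
Proof. by have [g adj] := qG; rewrite (ladj_unique adj). Qed.

Let qmul_tset (a b c : Q) : a * b <= c <-> tset (mS c) (a, b).
Proof. by rewrite [_ * _ <= _]m_adj; exact: pure_le. Qed.

Let invE : ladj (@iS G) = @iS G.
Proof.
apply/ladj_unique/involutive_adjoint; first exact: iS_involutive.
exact: fhom_Vee (iS_hom lgG).
Qed.

Let dS_right_sided w : (dS w : Q) * \top <= dS w.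
Proof.
by apply/qmul_tset; rewrite (lg_dm lgG); exact: @tset_pure _ _ _ _ _ _ _.
Qed.

Let id_hom := @frame_hom_id (gd1 G).
Let du_hom := frame_hom_comp (dS_hom lgG) (uS_hom lgG).

(** Right-sidedness of z means pi_1^* z <= m^* z.  The pullback of this along
    x |-> (x, x^-1) is z <= d^* u^* z, and its pullback along
    x |-> (u d x, x) is d^* u^* z <= z. *)
Lemma rightSidedE (z : R) : rsval z = dS (uS (rsval z)).
Proof.
have /qmul_tset/pure_le h := rsvalP z.
have iu w : id (rS w) = iS (dS w) :> gd1 G by rewrite (lg_di lgG).
have du w : dS (uS (rS w)) = id (dS w) :> gd1 G by rewrite (lg_ru lgG).
apply/le_anti/andP; split.
  have := fhom_le (tpair_hom id_hom (iS_hom lgG) iu) h.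
  by rewrite (tpair_tpi1 id_hom (iS_hom lgG) iu) (lg_invr lgG).
have := fhom_le (tpair_hom du_hom id_hom du) h.
by rewrite (tpair_tpi1 du_hom id_hom du) (lg_unitl lgG).
Qed.

Let sat (c : Q) : saturated (fun z : R => (rsval z)^*) (@rsval Q)
  [set xy | xy.1 * xy.2 <= c].
Proof.
have -> : [set xy : Q * Q | xy.1 * xy.2 <= c] = tset (mS c).
  by apply/seteqP; split=> -[x y] /qmul_tset.
have [h1 h2 h3] := tensor_saturated (mS c).
split=> // a z b; rewrite /= invE [rsval z]rightSidedE (lg_di lgG).
exact: h3.
Qed.

Let tset_m (a : Q) : tset (radj (@mu0 Q) a) = tset (mS a).
Proof. by rewrite radj_mu0 //; apply/seteqP; split=> -[x y] /qmul_tset. Qed.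

Let invK : involutive (@qinv Q).
Proof. by rewrite /= invE; exact: iS_involutive. Qed.

Let upsilonE (a : Q) : upsilon a = dS (uS a).
Proof.
by rewrite upsilon_tpair // (tpair_tset _ _ (tset_m a)) /= invE (lg_invr lgG).
Qed.

Let to_rs (w : gd0 G) : R := RightSided (dS_right_sided w).

Let to_rsK : cancel to_rs (fun z : R => uS (rsval z)).
Proof. by move=> w; exact: lg_du. Qed.

Let of_rsK : cancel (fun z : R => uS (rsval z)) to_rs.
Proof. by move=> z; apply: val_inj; rewrite [RHS]rightSidedE. Qed.

Let to_rs_hom : frame_hom to_rs.
Proof.
by apply: (frame_hom_cancel_inj (@rsval_hom Q) val_inj); exact: (dS_hom lgG).
Qed.

Let of_rs_hom : frame_hom (fun z : R => uS (rsval z)).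
Proof. exact: frame_hom_comp (uS_hom lgG) (@rsval_hom Q). Qed.

Let to_rs_u (a : Q) : to_rs (uS a) = uS (g := groupoid_of Q) a.
Proof.
by apply: val_inj; rewrite [RHS]groupoid_of_u ?upsilonE.
Qed.

Let tpair_tpi_tset (C C' A B : frameType) (f : C -> A) (g : C -> B)
    (f' : C' -> A) (g' : C' -> B) (U : tensor f g) (V : tensor f' g') :
  tset U = tset V ->
  tpair (tpi1 f' g') (tpi2 f' g') U = V.
Proof. by move=> e; rewrite (tpair_tset _ _ e) tpair_tpi. Qed.

Let functor_to : @functorS (groupoid_of Q) G to_rs id.
Proof.
split=> //.
- by move=> w; rewrite -(lg_di lgG) /= invE.
- by move=> a; rewrite /= invE.
- by move=> a; apply: tpair_tpi_tset; rewrite [RHS]tset_m.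
Qed.

Let functor_of : @functorS G (groupoid_of Q) (fun z : R => uS (rsval z)) id.
Proof.
split=> //.
- by move=> z; exact: rightSidedE.
- by move=> z; rewrite -(lg_di lgG) -rightSidedE /= invE.
- by move=> a; rewrite -to_rs_u to_rsK.
- by move=> a; rewrite /= invE.
- by move=> a; apply: tpair_tpi_tset; exact: tset_m.
Qed.

Lemma groupoid_of_quantale_of_localic : localic_groupoid (groupoid_of Q).
Proof.
exact: (localic_groupoid_transport lgG functor_to of_rs_hom id_hom of_rsK).
Qed.

Lemma groupoid_of_quantale_of : groupoid_iso (groupoid_of Q) G.
Proof.
by exists to_rs, id, (fun z : R => uS (rsval z)), id; split=> //; split=> // a.
Qed.
End QuantaleOfGroupoid.

Theorem theorem2p57 :
  (forall G : groupoidData, localic_groupoid G -> forall qG : quantal G,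
     localic_groupoid (groupoid_of (quantale_of qG)) /\
     groupoid_iso (groupoid_of (quantale_of qG)) G) /\
  (forall Q : preQuantalFrame, multiplicative_semiopen_quantal_frame Q ->
     localic_groupoid (groupoid_of Q) /\
     exists qQ : quantal (groupoid_of Q), quantale_iso (quantale_of qQ) Q).
Proof.
split=> [G lgG qG|Q hQ]; split.
- exact: groupoid_of_quantale_of_localic.
- exact: groupoid_of_quantale_of.
- exact: groupoid_of_localic.
- by exists (groupoid_of_quantal hQ); exact: quantale_of_groupoid_of.
Qed.
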